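(* Let $(\Phi,\Delta)$ be an infinite based root system in $(V,B)$ with associated Coxeter system $(W,S)$ and with $\Delta$ a basis of $V$. Let $\widehat\Phi$ be its set of normalized roots, $E$ the set of accumulation points of $\widehat\Phi$, and $D=V_1\setminus\bigcup_{w\in W}w(V_0)$, on which $W$ acts by $w\cdot x=\widehat{w(x)}$. Then: (i) $\widehat\Phi$ and $E$ are contained in $D$; (ii) $\widehat\Phi$ and $E$ are stable under the action of $W$; moreover $\widehat\Phi=W\cdot\Delta$; (iii) the topological closure $\widehat\Phi\sqcup E$ of $\widehat\Phi$ is stable under the action of $W$.
   Context: Let $V$ be a finite-dimensional real vector space with a symmetric bilinear form $B$. For $\alpha\in V$ with $B(\alpha,\alpha)\neq 0$, let $s_\alpha(v)=v-2\frac{B(\alpha,v)}{B(\alpha,\alpha)}\alpha$ for $v\in V$. A simple system is a finite subset $\Delta\subset V$ such that: (1) $\Delta$ is positively independent (if $\sum_{\alpha\in\Delta}\lambda_\alpha\alpha=0$ with all $\lambda_\alpha\ge 0$ then all $\lambda_\alpha=0$); (2) for distinct $\alpha,\beta\in\Delta$, $B(\alpha,\beta)\in(-\infty,-1]\cup\{-\cos(\pi/k): k\in\mathbb{Z}_{\ge 2}\}$; (3) $B(\alpha,\alpha)=1$ for all $\alpha\in\Delta$. Let $W$ be the subgroup of the orthogonal group $O_B(V)$ generated by $S=\{s_\alpha:\alpha\in\Delta\}$ and $\Phi=W(\Delta)$ the orbit of $\Delta$. The pair $(\Phi,\Delta)$ is called a based root system in $(V,B)$; $(W,S)$ is a Coxeter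 system. Let $\mathrm{cone}(\Delta)$ be the set of nonnegative linear combinations of $\Delta$ and $\Phi^+=\Phi\cap\mathrm{cone}(\Delta)$ the set of positive roots; then $\Phi=\Phi^+\sqcup(-\Phi^+)$. Standing assumptions: $\Delta$ is a basis of $V$ and $\Phi$ is infinite. For $v=\sum_{\alpha\in\Delta}v_\alpha\alpha$ put $|v|_1=\sum_{\alpha\in\Delta}v_\alpha$, $V_0=\{v:|v|_1=0\}$, $V_1=\{v:|v|_1=1\}$. For $v\in V\setminus V_0$ put $\widehat v=v/|v|_1\in V_1$. One has $\Phi\cap V_0=\emptyset$, and $\widehat\Phi=\{\widehat\rho:\rho\in\Phi\}$ is the set of normalized roots. $E=E(\Phi)$ is the set of accumulation points of $\widehat\Phi$, i.e. the set of all limits of convergent injective sequences of elements of $\widehat\Phi$. The set $D=\bigcap_{w\in W}w(V\setminus V_0)\cap V_1=V_1\setminus\bigcup_{w\in W}w(V_0)$ carries an action of $W$ given by $w\cdot x=\widehat{w(x)}$ for $w\in W$, $x\in D$. *)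

(* Defs.v *)
From HB Require Import structures.
From mathcomp Require Import all_boot all_order all_algebra.
From mathcomp Require Import all_classical all_reals all_analysis.

Set Implicit Arguments.
Unset Strict Implicit.
Unset Printing Implicit Defensive.

Import Order.TTheory GRing.Theory Num.Theory.
Import numFieldTopology.Exports numFieldNormedType.Exports.

Local Open Scope classical_set_scope.
Local Open Scope ring_scope.

(* The topology of a finite-dimensional real vector space, transported from
   row vectors along the linear coordinate isomorphism v2r; it does not depend
   on the choice of that isomorphism. *)
Definition euclidean (R : realType) (V : vectType R) : Type :=
  initial_topology (VectorInternalTheory.v2r : V -> 'rV[R]_(dim V)).

HB.instance Definition _ (R : realType) (V : vectType R) :=
  Topological.copy (euclidean V)
    (initial_topology (VectorInternalTheory.v2r : V -> 'rV[R]_(dim V))).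

Definition accumulation_points (R : realType) (V : vectType R) (A : set V) :
    set V :=
  [set x | exists u : nat -> V,
     [/\ injective u, forall n, A (u n) &
         (u : nat -> euclidean V) @ \oo --> (x : euclidean V)]].

Definition top_closure (R : realType) (V : vectType R) (A : set V) : set V :=
  closure (A : set (euclidean V)).

Section BasedRootSystem.
Variables (R : realType) (V : vectType R).
Variables (B : {symmetric V}) (Delta : seq V).

Definition reflection_fun (a v : V) : V :=
  v - (2 * (B a v / B a a)) *: a.

Lemma reflection_fun_linear a : linear (reflection_fun a).
Proof.
move=> k u v; rewrite /reflection_fun linearPr /= scalerBr scalerA.
by rewrite (mulrDl (k * _)) (mulrDr 2) -(mulrA k) (mulrCA 2 k) scalerDl opprD
  addrACA.
Qed.

HB.instance Definition _ a :=
  GRing.isLinear.Build R V V _ (reflection_fun a) (reflection_fun_linear a).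

Definition reflection (a : V) : 'End(V) := linfun (reflection_fun a).

Lemma reflectionE a v : reflection a v = v - (2 * (B a v / B a a)) *: a.
Proof. by rewrite lfunE. Qed.

Definition positively_independent : Prop :=
  forall lam : V -> R,
    (forall a, a \in Delta -> 0 <= lam a) ->
    \sum_(a <- Delta) lam a *: a = 0 ->
    forall a, a \in Delta -> lam a = 0.

Definition simple_system : Prop :=
  [/\ uniq Delta,
      positively_independent,
      (forall a b, a \in Delta -> b \in Delta -> a != b ->
         B a b <= -1 \/
         exists2 k : nat, (2 <= k)%N & B a b = - cos (pi / k%:R)) &
      forall a, a \in Delta -> B a a = 1].

Definition orthogonal_group : set 'End(V) :=
  [set f | lker f = 0%VS /\ forall u v, B (f u) (f v) = B u v].

(* On linear maps with zero kernel, f^-1%VF is the genuine inverse. *)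
Definition orthogonal_subgroup (G : set 'End(V)) : Prop :=
  [/\ G `<=` orthogonal_group,
      G \1%VF,
      (forall f g, G f -> G g -> G (f \o g)%VF) &
      forall f, G f -> G (f^-1)%VF].

Definition simple_reflections : set 'End(V) :=
  [set reflection a | a in [set` Delta]].

Definition weyl_group : set 'End(V) :=
  smallest orthogonal_subgroup simple_reflections.

Definition root_system : set V :=
  [set w a | w in weyl_group & a in [set` Delta]].

(* |v|_1; the coordinates are meaningful when Delta is a basis of V. *)
Definition coord_sum (v : V) : R :=
  \sum_(i < size Delta) coord (in_tuple Delta) i v.

Definition V0 : set V := [set v | coord_sum v = 0].
Definition V1 : set V := [set v | coord_sum v = 1].

(* Only meaningful outside V0. *)
Definition normalize (v : V) : V := (coord_sum v)^-1 *: v.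

Definition normalized_roots : set V := normalize @` root_system.

Definition limit_roots : set V := accumulation_points normalized_roots.

Definition act_domain : set V :=
  V1 `\` \bigcup_(w in weyl_group) ((fun v => w v) @` V0).

Definition proj_act (w : 'End(V)) (x : V) : V := normalize (w x).

Definition proj_act_stable (X : set V) : Prop :=
  forall w x, weyl_group w -> X x -> X (proj_act w x).

End BasedRootSystem.

(* Main.v *)
Require Import Defs.
From HB Require Import structures.
From mathcomp Require Import all_boot all_order all_algebra.
From mathcomp Require Import all_classical all_reals all_analysis.
From mathcomp Require Import ring lra zify.

Set Implicit Arguments.
Unset Strict Implicit.
Unset Printing Implicit Defensive.

Import Order.TTheory GRing.Theory Num.Theory.
Import numFieldTopology.Exports numFieldNormedType.Exports.

Local Open Scope classical_set_scope.
Local Open Scope ring_scope.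

(** Everything rests on one fact: each root is a nonnegative or a nonpositive
    combination of simple roots (root_system_cone). It follows from an exchange
    property of words in the simple reflections (exchange_neg): if w maps a simple
    root a to a vector that is not positive, then w s_a, or w itself, is represented
    by a shorter word. Splitting off from w a final factor in a and the last letter
    of w reduces this to a dihedral group, where the orbit of a root has explicit
    Chebyshev coefficients; they stay nonnegative until, for an angle pi / m, one of
    them vanishes at an alternating word of length m - 1, and then a cancellation
    shortens every longer word (dihedral_dichotomy).

    Consequently a root has nonzero coordinate sum, a normalized root lies in the
    cone, and s_a keeps in the cone every normalized root other than a
    (reflection_normalized_root). An injective sequence of normalized roots meets a
    at most once, so for a limit root x both x and s_a x lie in the closed cone
    (limit_root_reflection_cone). Since s_a x is not zero, its coordinate sum is
    positive, and s_a x can be normalized to the limit of the transformed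
    sequence: E is stable under the simple reflections, hence under W, and along
    any orbit the coordinate sum does not vanish, which is the inclusion in D.

    The same observation separates E from the normalized roots. If a simple root a
    were a limit root, then s_a a = - a would lie in the cone; and as both sets are
    stable under W, any common point could be moved to a simple root. Finally, in
    the metrizable topology of V a point of the closure of a set either belongs to
    it or is the limit of an injective sequence in it (top_closureE). *)

(** * Reflections and words *)

Section Reflections.
Variables (R : realType) (V : vectType R) (B : {symmetric V}).
Local Notation s := (reflection B).

Lemma formC u v : B u v = B v u.
Proof. by rewrite hermC expr0 mul1r. Qed.

Lemma reflection_unitE a v : B a a = 1 -> s a v = v - (2 * B a v) *: a.
Proof. by move=> a1; rewrite reflectionE a1 divr1. Qed.

Lemma reflection_id a : B a a = 1 -> s a a = - a.
Proof.
move=> a1; rewrite reflection_unitE // a1 mulr1 scaler_nat mulr2n opprD addrA.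
by rewrite subrr sub0r.
Qed.

Lemma reflectionK a : B a a = 1 -> involutive (s a).
Proof.
move=> a1 v; rewrite (reflection_unitE v a1) linearB linearZ /=.
by rewrite reflection_id // reflection_unitE // scalerN opprK subrK.
Qed.

Lemma reflection_isometry a u v : B a a = 1 -> B (s a u) (s a v) = B u v.
Proof.
move=> a1; rewrite !reflection_unitE // linearBr linearBl /= !linearZr !linearZl.
rewrite linearBl linearZl /= a1 (formC u a).
rewrite /GRing.scale /=; ring.
Qed.

Lemma isometry_reflection (f : 'End(V)) a v :
  (forall x y, B (f x) (f y) = B x y) -> f (s a v) = s (f a) (f v).
Proof. by move=> fB; rewrite !reflectionE !fB linearB linearZ. Qed.

Definition word_map (w : seq V) : 'End(V) :=
  foldr (fun a f => (s a \o f)%VF) \1%VF w.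

Lemma word_map_nil v : word_map [::] v = v.
Proof. by rewrite id_lfunE. Qed.

Lemma word_map_cons a w v : word_map (a :: w) v = s a (word_map w v).
Proof. by rewrite comp_lfunE. Qed.

Lemma word_map_cat u w v : word_map (u ++ w) v = word_map u (word_map w v).
Proof.
by elim: u => [|a u IH]; rewrite ?word_map_nil // cat_cons !word_map_cons IH.
Qed.

Lemma word_map_isometry (w : seq V) : (forall a, a \in w -> B a a = 1) ->
  forall x y, B (word_map w x) (word_map w y) = B x y.
Proof.
elim: w => [|a w IH] w1 x y; first by rewrite !word_map_nil.
rewrite !word_map_cons reflection_isometry ?w1 ?mem_head //.
by apply: IH => b bw; rewrite w1 // in_cons bw orbT.
Qed.

Lemma word_map_revK (w : seq V) : (forall a, a \in w -> B a a = 1) ->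
  cancel (word_map w) (word_map (rev w)).
Proof.
elim: w => [|a w IH] w1 v; first by rewrite !word_map_nil.
rewrite rev_cons -cats1 word_map_cat !word_map_cons word_map_nil.
rewrite reflectionK ?w1 ?mem_head //.
by apply: IH => b bw; rewrite w1 // in_cons bw orbT.
Qed.

Lemma word_map_Krev (w : seq V) : (forall a, a \in w -> B a a = 1) ->
  cancel (word_map (rev w)) (word_map w).
Proof.
move=> w1; rewrite -{2}(revK w); apply: word_map_revK => a.
by rewrite mem_rev; apply: w1.
Qed.

End Reflections.

Arguments word_map : simpl never.

(** * Dihedral computations *)

(** cheb c k is U_(k-1)(c) for the Chebyshev polynomials U of the second
    kind: for c = cos t it is sin (k t) / sin t. *)
Fixpoint cheb (R : pzRingType) (c : R) (k : nat) : R :=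
  match k with
  | 0 => 0
  | k1.+1 => match k1 with 0 => 1 | k2.+1 => 2 * c * cheb c k1 - cheb c k2 end
  end.

Lemma cheb0 (R : pzRingType) (c : R) : cheb c 0 = 0. Proof. by []. Qed.

Lemma cheb1 (R : pzRingType) (c : R) : cheb c 1 = 1. Proof. by []. Qed.

Lemma chebSS (R : pzRingType) (c : R) k :
  cheb c k.+2 = 2 * c * cheb c k.+1 - cheb c k.
Proof. by []. Qed.

Arguments cheb : simpl never.

Lemma cheb_ge1 (R : realDomainType) (c : R) k : 1 <= c ->
  0 <= cheb c k <= cheb c k.+1.
Proof.
move=> c1; elim: k => [|k /andP[k0 kk]]; first by rewrite cheb0 cheb1 ler01 lexx.
rewrite chebSS (le_trans k0 kk) andTb.
have : 0 <= (c - 1) * cheb c k.+1 by rewrite mulr_ge0 ?subr_ge0 ?(le_trans k0).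
move: (cheb c k.+1) (cheb c k) kk => p q qp; rewrite mulrBl mul1r => cp.
by rewrite -mulrA; lra.
Qed.

Lemma cheb_cos (R : realType) (t : R) k :
  cheb (cos t) k * sin t = sin (k%:R * t).
Proof.
suff: cheb (cos t) k * sin t = sin (k%:R * t) /\
      cheb (cos t) k.+1 * sin t = sin (k.+1%:R * t) by case.
elim: k => [|k [IH1 IH2]]; first by rewrite cheb0 cheb1 !mul0r sin0 !mul1r.
split=> //; rewrite chebSS mulrBl -mulrA IH1 IH2.
have -> : k%:R * t = k.+1%:R * t - t by rewrite -natr1; ring.
have -> : k.+2%:R * t = k.+1%:R * t + t by rewrite -natr1; ring.
rewrite sinB sinD; ring.
Qed.

Section ChebFinite.
Variables (R : realType) (m : nat).
Hypothesis m2 : (2 <= m)%N.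
Local Notation t := (pi / m%:R : R).

Let m0 : (0 : R) < m%:R. Proof. by rewrite ltr0n; lia. Qed.

Let sin_t : 0 < sin t.
Proof.
apply: sin_gt0_pi; rewrite divr_gt0 ?pi_gt0 //= ltr_pdivrMr //.
by rewrite ltr_pMr ?pi_gt0 // ltr1n.
Qed.

Lemma cheb_cos_ge0 k : (k <= m)%N -> 0 <= cheb (cos t) k.
Proof.
move=> km; rewrite -(pmulr_lge0 _ sin_t) cheb_cos sin_ge0_pi //.
rewrite mulr_ge0 ?divr_ge0 ?pi_ge0 ?ler0n //= mulrCA.
by rewrite ler_piMr ?pi_ge0 // ler_pdivrMr // mul1r ler_nat.
Qed.

Lemma cheb_cos_m : cheb (cos t) m = 0.
Proof.
apply: (mulIf (lt0r_neq0 sin_t)); rewrite cheb_cos mul0r.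
by rewrite mulrCA divff ?gt_eqF // mulr1 sinpi.
Qed.

Lemma cheb_cos_m1 : cheb (cos t) m.-1 = 1.
Proof.
apply: (mulIf (lt0r_neq0 sin_t)); rewrite cheb_cos mul1r.
have -> : m.-1%:R * t = pi - t.
  have -> : m.-1%:R = m%:R - 1 :> R by rewrite -[in RHS](prednK (ltnW m2)) -natr1 addrK.
  by rewrite mulrBl mul1r mulrCA divff ?gt_eqF // mulr1.
by rewrite sinB sinpi cospi; ring.
Qed.

End ChebFinite.

Definition coxeter_value (R : realType) (x : R) : Prop :=
  x <= -1 \/ exists2 k : nat, (2 <= k)%N & x = - cos (pi / k%:R).

Section Dihedral.
Variables (R : realType) (V : vectType R) (B : {symmetric V}) (a b : V).
Hypotheses (a1 : B a a = 1) (b1 : B b b = 1).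
Local Notation s := (reflection B).
Local Notation word := (word_map B).
Local Notation c := (- B a b).

Definition alt_letter k := if odd k then b else a.

(** Letters are numbered from the right, so that a longer word extends a shorter
    one on the left; the word ends in b because a final a would cancel against s_a. *)
Fixpoint alt_word k : seq V :=
  if k is k1.+1 then alt_letter k :: alt_word k1 else [::].

Lemma size_alt_word k : size (alt_word k) = k.
Proof. by elim: k => //= k ->. Qed.

Lemma alt_letterSS k : alt_letter k.+2 = alt_letter k.
Proof. by rewrite /alt_letter /= negbK. Qed.

Lemma alt_letter_mem k : alt_letter k \in [:: a; b].
Proof. by rewrite /alt_letter; case: ifP; rewrite !inE eqxx ?orbT. Qed.

Lemma alt_word_sub k : {subset alt_word k <= [:: a; b]}.
Proof.
by elim: k => //= k IH x; rewrite inE => /orP[/eqP->|/IH//]; apply: alt_letter_mem.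
Qed.

Lemma alt_letter_unit k : B (alt_letter k) (alt_letter k) = 1.
Proof. by rewrite /alt_letter; case: ifP. Qed.

Lemma alt_letter_form k : B (alt_letter k.+1) (alt_letter k) = B a b.
Proof. by rewrite /alt_letter /=; case: (odd k) => //=; rewrite formC. Qed.

Lemma alt_word_root k : word (alt_word k) a =
  cheb c k.+1 *: alt_letter k + cheb c k *: alt_letter k.+1.
Proof.
elim: k => [|k IH]; first by rewrite word_map_nil cheb1 cheb0 scale1r scale0r addr0.
rewrite word_map_cons IH linearD !linearZ /=.
rewrite reflection_id ?alt_letter_unit // reflection_unitE ?alt_letter_unit //.
rewrite alt_letter_form alt_letterSS chebSS.
rewrite scalerBr scalerA scalerN -addrA -opprD -scalerDl addrC -scaleNr.
by congr (_ *: _ + _); ring.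
Qed.

(** Allowing the shorter word to represent w itself dispenses with any notion of
    reduced word in the inductions below. *)
Definition shortens (L w : seq V) : Prop := exists w' : seq V,
  [/\ {subset w' <= L}, (size w' < size w)%N &
      (word w' =1 word w) \/ (word w' =1 word w \o s a)].

Lemma shortens_cons L x w : x \in L -> shortens L w -> shortens L (x :: w).
Proof.
move=> xL [w' [w'L sz e]]; exists (x :: w'); split=> //.
  by move=> y; rewrite inE => /orP[/eqP->|/w'L].
by case: e => e; [left|right] => v; rewrite /= !word_map_cons e.
Qed.

(** Equal neighbours in w cancel, and a final letter a cancels against s_a. A word
    without equal neighbours that ends in b is alternating. *)
Lemma alt_or_shortens (w : seq V) : {subset w <= [:: a; b]} ->
  w = alt_word (size w) \/ shortens [:: a; b] w.
Proof.
elim: w => [|x w IH] wab; first by left.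
have xab : x \in [:: a; b] by apply: wab; rewrite mem_head.
case: IH => [y yw|ew|]; first by apply: wab; rewrite inE yw orbT.
- have [ex|nx] := eqVneq x (alt_letter (size w).+1); first by left; rewrite /= {1}ew ex.
  have {nx} ex : x = alt_letter (size w).
    move: xab nx; rewrite /alt_letter !inE /=; case: (odd _) => /=;
      by case/orP=> /eqP-> //; rewrite eqxx.
  right; case: (size w) ew ex => [|k] -> ex.
    exists [::]; split=> //; right=> v /=.
    rewrite word_map_cons ex !word_map_nil /alt_letter /=.
    by rewrite reflectionK.
  exists (alt_word k); split; [exact: alt_word_sub|by rewrite /= size_alt_word|left=> v].
  by rewrite ex /= !word_map_cons reflectionK ?alt_letter_unit.
- by move=> sw; right; apply: shortens_cons.
Qed.

(** For B a b = - cos (pi / m), the alternating word u of length m - 1 maps a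
    to the letter g that precedes u in the alternating word of length m. Hence
    u s_a = s_g u, and s_g u s_a = u. *)
Lemma alt_word_shortens m k : (2 <= m)%N -> B a b = - cos (pi / m%:R) ->
  (m <= k)%N -> shortens [:: a; b] (alt_word k).
Proof.
move=> m2 eB; elim: k => [|k IH] mk; first by move: m2; rewrite leqn0 in mk; rewrite (eqP mk).
have [{}mk|] := leqP m k; first by apply: shortens_cons (alt_letter_mem _) (IH mk).
move=> km; have {mk km} em : m = k.+1 by lia.
exists (alt_word k); split; [exact: alt_word_sub|by rewrite /= size_alt_word|right=> v].
have root : word (alt_word k) a = alt_letter k.+1.
  rewrite alt_word_root eB opprK -em cheb_cos_m // scale0r add0r.
  by rewrite -[k]/(k.+1.-1) -em cheb_cos_m1 // scale1r.
rewrite /= word_map_cons isometry_reflection; last first.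
  apply: word_map_isometry => x /alt_word_sub; rewrite !inE.
  by case/orP=> /eqP->.
by rewrite root reflectionK ?alt_letter_unit.
Qed.

(** The Chebyshev coefficients of an alternating word never decrease when
    B a b <= -1; when B a b = - cos (pi / m), they have the signs of sines on [0, pi]
    as long as the word has fewer than m letters, and longer words shorten. *)
Lemma dihedral_dichotomy (w : seq V) : coxeter_value (B a b) ->
  {subset w <= [:: a; b]} ->
  (exists x y : R, [/\ 0 <= x, 0 <= y & word w a = x *: a + y *: b]) \/
  shortens [:: a; b] w.
Proof.
move=> cv /alt_or_shortens[->|]; last by right.
set k := size w.
have pos : 0 <= cheb c k -> 0 <= cheb c k.+1 -> exists x y : R,
    [/\ 0 <= x, 0 <= y & word (alt_word k) a = x *: a + y *: b].
  rewrite alt_word_root /alt_letter /= => p0 p1; case: (odd k) => /=.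
    by exists (cheb c k), (cheb c k.+1); rewrite addrC.
  by exists (cheb c k.+1), (cheb c k).
case: cv => [le|[m m2 eB]].
  have c1 : 1 <= c by rewrite lerNr.
  have /andP[p0 p1] := cheb_ge1 k c1.
  by left; apply: pos => //; apply: le_trans p1.
have [mk|km] := leqP m k; first by right; apply: alt_word_shortens mk.
by left; apply: pos; rewrite eB opprK cheb_cos_ge0 // ltnW.
Qed.

End Dihedral.

(** * Positive and negative roots *)

Section Roots.
Variables (R : realType) (V : vectType R) (B : {symmetric V}) (Delta : seq V).
Hypotheses (hD : simple_system B Delta) (hb : basis_of {:V} Delta).
Local Notation s := (reflection B).
Local Notation word := (word_map B).
Local Notation W := (weyl_group B Delta).
Local Notation x_ i := (coord (in_tuple Delta) i).

Lemma simple_unit a : a \in Delta -> B a a = 1.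
Proof. by case: hD => _ _ _; apply. Qed.

Lemma words_unit (w : seq V) : {subset w <= Delta} -> forall a, a \in w -> B a a = 1.
Proof. by move=> wD a /wD /simple_unit. Qed.

Lemma coord_simple (i j : 'I_(size Delta)) : x_ j Delta`_i = (i == j)%:R.
Proof. exact: (coord_free (X := in_tuple Delta)) (basis_free hb). Qed.

Lemma simple_nth a : a \in Delta ->
  exists i : 'I_(size Delta), a = Delta`_i.
Proof. by move=> /(nthP 0)[i lt <-]; exists (Ordinal lt). Qed.

Lemma coord_inj u v : (forall i, x_ i u = x_ i v) -> u = v.
Proof.
move=> uv; rewrite (coord_basis (X := in_tuple Delta) hb (memvf u)).
rewrite [RHS](coord_basis (X := in_tuple Delta) hb (memvf v)).
by apply: eq_bigr => i _; rewrite uv.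
Qed.

Definition in_cone (v : V) : bool := [forall i, 0 <= x_ i v].

Lemma in_coneP v : reflect (forall i, 0 <= x_ i v) (in_cone v).
Proof. exact: forallP. Qed.

Lemma in_cone_comb (x y : R) u v : 0 <= x -> 0 <= y -> in_cone u -> in_cone v ->
  in_cone (x *: u + y *: v).
Proof.
move=> x0 y0 /in_coneP u0 /in_coneP v0; apply/in_coneP => i.
by rewrite linearD !linearZ addr_ge0 //= mulr_ge0.
Qed.

Lemma in_cone_simple a : a \in Delta -> in_cone a.
Proof. by case/simple_nth=> j ->; apply/in_coneP => i; rewrite coord_simple. Qed.

(** Write w = v d with d a word in a and the last letter t of w, and v as short as
    possible. If v maps x = a or x = t outside the cone, then by induction v or
    v s_x has an expression shorter than v: the former shortens w, the latter
    trades a letter of v for a letter x of d. Otherwise d cannot map a to a nonnegative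
    combination of a and t, as w a would be positive, so d can be shortened inside
    the dihedral group of a and t. *)
Lemma exchange_neg a (w : seq V) : a \in Delta -> {subset w <= Delta} ->
  ~~ in_cone (word w a) -> shortens B a Delta w.
Proof.
have [n] := ubnP (size w); elim: n a w => // n IHn a w ltwn aD wD neg.
(* Quantifying over all factorizations w = v d allows v to shrink by induction. *)
suff fact : forall (t : V) (v d : seq V), t \in Delta -> a != t -> {subset v <= Delta} ->
    {subset d <= [:: a; t]} -> (size v + size d <= size w)%N ->
    (size v < size w)%N -> word (v ++ d) =1 word w -> shortens B a Delta w.
  case/lastP: w wD ltwn neg fact => [|w t] wD ltwn neg fact.
    by move: neg; rewrite word_map_nil in_cone_simple.
  have tD : t \in Delta by apply: wD; rewrite mem_rcons mem_head.
  have w1D : {subset w <= Delta} by move=> y yw; apply: wD; rewrite mem_rcons inE yw orbT.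
  have [eat|nat] := eqVneq a t.
    exists w; split=> //; first by rewrite size_rcons.
    right=> v; rewrite /comp -cats1 word_map_cat word_map_cons word_map_nil -eat.
    by rewrite reflectionK // simple_unit.
  apply: (fact t w [:: t]) => //; rewrite ?size_rcons ?addn1 //; last by rewrite cats1.
  by move=> y; rewrite !inE => ->; rewrite orbT.
move=> t v d tD nat.
have [k] := ubnP (size v); elim: k v d => // k IHk v d ltvk vD dat vdw vw ewd.
have dD : {subset d <= Delta} by move=> y /dat; rewrite !inE => /orP[] /eqP->.
have catD (v1 d1 : seq V) : {subset v1 <= Delta} -> {subset d1 <= Delta} ->
    {subset v1 ++ d1 <= Delta}.
  by move=> v1D d1D y; rewrite mem_cat => /orP[/v1D|/d1D].
have abs u : u \in Delta -> u \in [:: a; t] -> ~~ in_cone (word v u) -> shortens B a Delta w.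
  have vn : (size v < n)%N by apply: leq_trans vw ltwn.
  move=> uD uat /(IHn u v vn uD vD)[v' [v'D v'v [e|e]]].
  - exists (v' ++ d); split; [exact: catD|by rewrite size_cat (leq_trans _ vdw) // ltn_add2r|left=> x].
    by rewrite word_map_cat e -word_map_cat ewd.
  - apply: (IHk v' (u :: d)) => //.
    + exact: leq_trans v'v ltvk.
    + by move=> y; rewrite inE => /orP[/eqP->|/dat].
    + by rewrite /= addnS -addSn (leq_trans _ vdw) // leq_add2r.
    + exact: ltn_trans v'v vw.
    move=> x; rewrite word_map_cat e /comp word_map_cons reflectionK ?simple_unit //.
    by rewrite -word_map_cat ewd.
have [pa|] := boolP (in_cone (word v a)); last by apply: abs; rewrite // mem_head.
have [pt|] := boolP (in_cone (word v t)); last by apply: abs; rewrite // !inE eqxx orbT.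
have cv : coxeter_value (B a t) by case: hD => _ _ + _; apply.
have [[x [y [x0 y0 e]]]|[d' [d'at d'd e]]] :=
    dihedral_dichotomy (simple_unit aD) (simple_unit tD) cv dat.
  by case/negP: neg; rewrite -ewd word_map_cat e linearD !linearZ in_cone_comb.
exists (v ++ d'); split.
- by apply: catD => // y /d'at; rewrite !inE => /orP[] /eqP->.
- by rewrite size_cat (leq_trans _ vdw) // ltn_add2l.
case: e => e; [left|right] => x; first by rewrite word_map_cat e -word_map_cat ewd.
by rewrite word_map_cat e /comp -word_map_cat ewd.
Qed.

(** The shorter word for w s_a maps a to - w a, whose sign is known by induction. *)
Lemma root_pos_neg a (w : seq V) : a \in Delta -> {subset w <= Delta} ->
  in_cone (word w a) || in_cone (- word w a).
Proof.
move=> aD; have [n] := ubnP (size w); elim: n w => // n IH w ltwn wD.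
have [//|neg] := boolP (in_cone (word w a)).
have [w' [w'D w'w [e|e]]] := exchange_neg aD wD neg.
  by have := IH w'; rewrite e (negbTE neg); apply=> //; exact: leq_trans w'w ltwn.
have := IH w'; rewrite e /comp reflection_id ?simple_unit // linearN opprK orbC.
by rewrite (negbTE neg); apply=> //; exact: leq_trans w'w ltwn.
Qed.

(** * The group W and its roots *)

Definition word_group : set 'End(V) :=
  [set f | exists2 w : seq V, {subset w <= Delta} & f = word w].

(** W is an intersection of orthogonal subgroups; that this is one of them makes
    every element of W a product of simple reflections. *)
Lemma word_group_subgroup : orthogonal_subgroup B word_group.
Proof.
have ker w : {subset w <= Delta} -> lker (word w) == 0%VS.
  by move=> wD; apply/lker0P; apply: can_inj (word_map_revK (words_unit wD)).
split.
- move=> _ [w wD ->]; split; first exact/eqP/ker.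
  exact/word_map_isometry/words_unit.
- by exists [::].
- move=> _ _ [u uD ->] [w wD ->]; exists (u ++ w).
    by move=> y; rewrite mem_cat => /orP[/uD|/wD].
  by apply/lfunP => v; rewrite comp_lfunE word_map_cat.
- move=> _ [w wD ->]; exists (rev w); first by move=> y; rewrite mem_rev; apply: wD.
  apply/lfunP => v; rewrite -{1}(word_map_Krev (words_unit wD) v).
  by rewrite lker0_lfunK // ker.
Qed.

Lemma weyl_group_word : W `<=` word_group.
Proof.
move=> f Wf; apply: (Wf word_group); split; first exact: word_group_subgroup.
move=> _ [a aD <-]; exists [:: a]; first by move=> y; rewrite inE => /eqP->.
by apply/lfunP => v; rewrite word_map_cons word_map_nil.
Qed.

End Roots.

(** * The topology of the ambient space *)

Section Topology.
Import VectorInternalTheory.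
Variables (R : realType) (V : vectType R).

Definition vdist (x y : V) : R := `|v2r x - v2r y|.

Lemma vdist_gt0 x y : x != y -> 0 < vdist x y.
Proof.
by move=> xy; rewrite normr_gt0 subr_eq0; apply: contraNneq xy => /v2r_inj->.
Qed.

Lemma euclidean_nbhsP (x : V) (U : set V) :
  nbhs (x : euclidean V) U <->
  exists2 e : R, 0 < e & forall y, vdist x y < e -> U y.
Proof.
split=> [|[e e0 eU]].
  rewrite nbhsE => -[_ [[A oA <-] Ax] AU].
  have /nbhs_ballP[e /= e0 eA] : nbhs (v2r x) A by apply: open_nbhs_nbhs.
  exists e => // y xy; apply: AU; apply: eA.
  by rewrite mx_norm_ball.
rewrite nbhsE; exists (v2r @^-1` (ball (v2r x) e)^°).
  split; last exact: nbhsx_ballx.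
  by exists (ball (v2r x) e)^°; first exact: open_interior.
by move=> y /= /interior_subset; rewrite mx_norm_ball; apply: eU.
Qed.

Lemma euclidean_cvgP (u : nat -> V) (x : V) :
  ((u : nat -> euclidean V) @ \oo --> (x : euclidean V)) <->
  (forall e : R, 0 < e -> \forall n \near \oo, vdist x (u n) < e).
Proof.
split=> [ux e e0|ux U /euclidean_nbhsP[e e0 eU]].
  by apply: (ux [set y | vdist x y < e]); apply/euclidean_nbhsP; exists e.
by rewrite /nbhs /=; apply: filterS (ux e e0) => n; apply: eU.
Qed.

Lemma vdist_ltP x y e : 0 < e ->
  vdist x y < e <-> forall j, `|v2r x 0 j - v2r y 0 j| < e.
Proof.
move=> e0; have -> : (vdist x y < e) = ball_ Num.norm (v2r x) e (v2r y) :> Prop by [].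
rewrite -mx_norm_ball; split=> [[_ xy] j|xy]; first exact: xy.
by split=> // i j; rewrite ord1; apply: xy.
Qed.

Lemma euclidean_cvg_coordP (u : nat -> V) (x : V) :
  ((u : nat -> euclidean V) @ \oo --> (x : euclidean V)) <->
  (forall j, v2r (u n) 0 j @[n --> \oo] --> v2r x 0 j).
Proof.
split=> [/euclidean_cvgP ux j|ux]; first apply/cvgrPdist_lt => e e0.
  by apply: filterS (ux e e0) => n /(vdist_ltP _ _ e0).
apply/euclidean_cvgP => e e0.
have : \forall n \near \oo, forall j, `|v2r x 0 j - v2r (u n) 0 j| < e.
  by apply: filter_forall => j; move/cvgrPdist_lt: (ux j); apply.
by apply: filterS => n xu; apply/(vdist_ltP _ _ e0).
Qed.

Lemma euclidean_cvg_scalar (phi : {scalar V}) (u : nat -> V) (x : V) :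
  ((u : nat -> euclidean V) @ \oo --> (x : euclidean V)) ->
  phi (u n) @[n --> \oo] --> phi x.
Proof.
move=> /euclidean_cvg_coordP ux.
have phiE v : phi v = \sum_j v2r v 0 j * phi (r2v (delta_mx 0 j)).
  rewrite -{1}(v2rK v) {1}(row_sum_delta (v2r v)) !linear_sum.
  by apply: eq_bigr => j _; rewrite !linearZ.
rewrite phiE; under eq_fun do rewrite phiE.
apply: (cvg_big (op := +%R)) => [|j _]; first exact: add_continuous.
exact: cvgMl (ux j).
Qed.

Lemma euclidean_cvg_of_scalars (u : nat -> V) (x : V) :
  (forall phi : {scalar V}, phi (u n) @[n --> \oo] --> phi x) ->
  ((u : nat -> euclidean V) @ \oo --> (x : euclidean V)).
Proof.
move=> ux; apply/euclidean_cvg_coordP => j.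
pose phi v := v2r v 0 j.
have lphi : scalar phi by move=> k a b; rewrite /phi linearP !mxE.
pose phiL := GRing.isLinear.Build R V R *%R phi lphi.
exact: (ux (HB.pack phi phiL)).
Qed.

(** Each point of the sequence is chosen at less than half of the distance from x
    to the previous one: the distances tend to 0 and strictly decrease, and the
    latter makes the sequence injective. *)
Lemma closure_accumulation (A : set V) (x : V) :
  top_closure A x -> ~ A x -> accumulation_points A x.
Proof.
move=> clx nAx.
(* The positivity of e goes inside, so that choice yields a total function. *)
have near_pt e : exists y, 0 < e -> A y /\ vdist x y < e.
  have [e0|] := pselect (0 < e); last by exists x.
  have [|y [Ay xy]] := clx [set y | vdist x y < e].
    by apply/euclidean_nbhsP; exists e.
  by exists y.
have [f fP] := choice near_pt.
have fA e : 0 < e -> A (f e) by move=> /fP[].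
have fx e : 0 < e -> vdist x (f e) < e by move=> /fP[].
pose u := fix u n := if n is k.+1 then f (vdist x (u k) / 2) else f 1.
have xA y : A y -> 0 < vdist x y.
  by move=> Ay; apply: vdist_gt0; apply/eqP => xy; apply: nAx; rewrite xy.
have uA n : A (u n).
  by elim: n => [|n IH] /=; apply: fA; rewrite ?divr_gt0 ?xA.
have uS n : vdist x (u n.+1) < vdist x (u n) / 2.
  by rewrite /=; apply: fx; rewrite divr_gt0 ?xA.
have udec i j : (i < j)%N -> vdist x (u j) < vdist x (u i).
  apply: (homo_ltn (f := fun n => vdist x (u n)) (r := fun p q => q < p)) => [p q r qp rq|n].
    exact: lt_trans rq qp.
  by apply: lt_trans (uS n) _; rewrite ltr_pdivrMr // ltr_pMr ?xA // ltr1n.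
exists u; split=> //.
  move=> i j uij; have [ij|ji|//] := ltngtP i j.
    by have := udec _ _ ij; rewrite uij ltxx.
  by have := udec _ _ ji; rewrite uij ltxx.
have ule n : vdist x (u n) <= 2^-1 ^+ n.
  elim: n => [|n IH]; first by rewrite expr0 ltW //; apply: fx.
  by rewrite exprSr (le_trans (ltW (uS n))) // ler_pM2r.
apply/euclidean_cvgP => e e0.
have := @cvg_expr R (2^-1); rewrite ger0_norm // invf_lt1 // ltr1n => /(_ isT).
move=> /cvgr0Pnorm_lt /(_ _ e0); apply: filterS => n.
by apply: le_lt_trans; rewrite ger0_norm // exprn_ge0.
Qed.

Lemma accumulation_closure (A : set V) (x : V) :
  accumulation_points A x -> top_closure A x.
Proof.
move=> [u [_ uA ux]] U xU; have [n _ un] := ux U xU.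
by exists (u n); split; [exact: uA|apply: un => /=].
Qed.

Lemma top_closureE (A : set V) : top_closure A = A `|` accumulation_points A.
Proof.
apply/seteqP; split=> x.
  by move=> clx; have [Ax|nAx] := pselect (A x); [left|right; exact: closure_accumulation].
by case=> [Ax|/accumulation_closure//]; apply: (@subset_closure (euclidean V)).
Qed.

End Topology.

Arguments euclidean_cvg_scalar {R V} phi {u x}.

(** * Normalized roots and limit roots *)

Lemma coord_sum_scalar (R : realType) (V : vectType R) (Delta : seq V) :
  scalar (coord_sum Delta).
Proof.
move=> k u v; rewrite /coord_sum mulr_sumr -big_split /=.
by apply: eq_bigr => i _; rewrite linearP.
Qed.

HB.instance Definition _ (R : realType) (V : vectType R) (Delta : seq V) :=
  GRing.isLinear.Build R V R *%R (coord_sum Delta) (coord_sum_scalar Delta).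

Section LimitRoots.
Variables (R : realType) (V : vectType R) (B : {symmetric V}) (Delta : seq V).
Hypotheses (hD : simple_system B Delta) (hb : basis_of {:V} Delta).
Local Notation s := (reflection B).
Local Notation W := (weyl_group B Delta).
Local Notation csum := (coord_sum Delta).
Local Notation x_ i := (coord (in_tuple Delta) i).
Local Notation hPhi := (normalized_roots B Delta).
Local Notation E := (limit_roots B Delta).
Local Notation nrm := (normalize Delta).
Local Notation in_cone := (in_cone Delta).

Lemma coord_sum_simple a : a \in Delta -> csum a = 1.
Proof.
case/simple_nth=> i ->; rewrite /coord_sum (bigD1 i) //= big1 => [|j ji].
  by rewrite coord_simple // eqxx addr0.
by rewrite coord_simple // eq_sym (negbTE ji).
Qed.

Lemma coord_sum_gt0 v : in_cone v -> v != 0 -> 0 < csum v.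
Proof.
move=> /in_coneP v0 vn0; rewrite lt_def sumr_ge0 ?andbT //.
apply: contra vn0; rewrite psumr_eq0 // => /allP v00.
apply/eqP/(coord_inj hb) => i; rewrite linear0; apply/eqP/v00.
by rewrite mem_index_enum.
Qed.

Lemma coord_sumZ k v : csum (k *: v) = k * csum v.
Proof. exact: linearZ. Qed.

Lemma normalizeZ k v : k != 0 -> nrm (k *: v) = nrm v.
Proof.
by move=> k0; rewrite /normalize coord_sumZ scalerA invfM mulrAC mulVf ?mul1r.
Qed.

Lemma normalize_id v : csum v = 1 -> nrm v = v.
Proof. by rewrite /normalize => ->; rewrite invr1 scale1r. Qed.

Lemma coord_sum_normalize v : csum v != 0 -> csum (nrm v) = 1.
Proof. by move=> v0; rewrite coord_sumZ mulVf. Qed.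

Lemma normalize_lfun (f : 'End(V)) v : csum v != 0 -> nrm (f (nrm v)) = nrm (f v).
Proof. by move=> v0; rewrite {2}/normalize linearZ normalizeZ ?invr_eq0. Qed.

Lemma weyl_reflection a : a \in Delta -> W (s a).
Proof. by move=> aD G [_ Gref]; apply: Gref; exists a. Qed.

Lemma weyl_id : W \1%VF.
Proof. by move=> G [[]]. Qed.

Lemma weyl_comp f g : W f -> W g -> W (f \o g)%VF.
Proof.
by move=> Wf Wg G GP; have [[_ _ + _] _] := GP; apply; [apply: Wf|apply: Wg].
Qed.

Lemma weyl_inv f : W f -> W f^-1%VF.
Proof. by move=> Wf G GP; have [[_ _ _ +] _] := GP; apply; apply: Wf. Qed.

Lemma weyl_lker f : W f -> lker f == 0%VS.
Proof.
move/(weyl_group_word hD); have [sub _ _ _] := word_group_subgroup hD.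
by move=> /sub[-> _].
Qed.

Lemma simple_root_system a : a \in Delta -> root_system B Delta a.
Proof.
by move=> aD; exists \1%VF; [exact: weyl_id|exists a => //; rewrite id_lfunE].
Qed.

Lemma root_system_weyl f r :
  W f -> root_system B Delta r -> root_system B Delta (f r).
Proof.
move=> Wf [g Wg [a aD <-]]; exists (f \o g)%VF; first exact: weyl_comp.
by exists a => //; rewrite comp_lfunE.
Qed.

Lemma root_system_neq0 r : root_system B Delta r -> r != 0.
Proof.
move=> [f Wf [a aD <-]]; rewrite -(linear0 f) (inj_eq (lker0P (weyl_lker Wf))).
by apply: contra_eq_neq (coord_sum_simple aD) => ->; rewrite linear0 eq_sym oner_eq0.
Qed.

Lemma root_system_cone r : root_system B Delta r -> in_cone r || in_cone (- r).
Proof.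
move=> [f /(weyl_group_word hD)[w wD ->] [a aD <-]]; exact: root_pos_neg.
Qed.

Lemma coord_sum_root r : root_system B Delta r -> csum r != 0.
Proof.
move=> Pr; have r0 := root_system_neq0 Pr.
case/orP: (root_system_cone Pr) => rc; first by rewrite gt_eqF ?coord_sum_gt0.
by rewrite -oppr_eq0 -linearN gt_eqF ?coord_sum_gt0 ?oppr_eq0.
Qed.

Lemma normalized_rootP x : hPhi x -> in_cone x /\ csum x = 1.
Proof.
move=> [r Pr <-]; split; last exact/coord_sum_normalize/coord_sum_root.
have r0 := root_system_neq0 Pr.
case/orP: (root_system_cone Pr) => rc.
  have cr := coord_sum_gt0 rc r0.
  by rewrite -[nrm r]addr0 -(scale0r r) in_cone_comb // invr_ge0 ltW.
have cr := coord_sum_gt0 rc; rewrite oppr_eq0 in cr.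
rewrite -(@normalizeZ (-1)) ?oppr_eq0 ?oner_eq0 // scaleN1r -[nrm _]addr0.
by rewrite -(scale0r (- r)) in_cone_comb // invr_ge0 ltW ?cr.
Qed.

Lemma stable_simple (X : set V) :
  (forall x, X x -> csum x = 1) ->
  (forall a x, a \in Delta -> X x -> csum (s a x) != 0 /\ X (nrm (s a x))) ->
  forall f x, W f -> X x -> csum (f x) != 0 /\ X (nrm (f x)).
Proof.
move=> X1 Xs f x /(weyl_group_word hD)[w wD ->] Xx.
elim: w wD => [|a w IH] wD; first by rewrite word_map_nil normalize_id ?X1 ?oner_eq0.
have [|n0 Xw] := IH; first by move=> y yw; apply: wD; rewrite inE yw orbT.
have aD : a \in Delta by apply: wD; rewrite mem_head.
have [] := Xs a _ aD Xw.
rewrite normalize_lfun // word_map_cons {1}/normalize linearZ coord_sumZ mulf_eq0 negb_or.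
by case/andP.
Qed.

(** A point f v with v in V0 is moved to V0 by the inverse of f. *)
Lemma stable_act_domain (X : set V) :
  (forall x, X x -> csum x = 1) ->
  (forall f x, W f -> X x -> csum (f x) != 0) -> X `<=` act_domain B Delta.
Proof.
move=> X1 Xn x Xx; split; first exact: X1.
move=> [f Wf [v v0 fv]]; have := Xn _ _ (weyl_inv Wf) Xx.
by rewrite -fv lker0_lfunK ?weyl_lker // v0 eqxx.
Qed.

Lemma normalized_roots_stable f x : W f -> hPhi x ->
  csum (f x) != 0 /\ hPhi (nrm (f x)).
Proof.
move=> Wf [r Pr <-]; have Pf := root_system_weyl Wf Pr.
have [r0 fr0] := (coord_sum_root Pr, coord_sum_root Pf).
rewrite normalize_lfun //; split; last by exists (f r).
by rewrite /normalize linearZ coord_sumZ mulf_neq0 ?invr_eq0.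
Qed.

(** A simple reflection s_a changes only the coordinate at a. A normalized root
    x other than a has a positive coordinate elsewhere, and this coordinate
    decides the sign of the root that is proportional to s_a x. *)
Lemma reflection_normalized_root a x : a \in Delta -> hPhi x -> x != a ->
  in_cone (s a x).
Proof.
move=> aD Px xa; have [/in_coneP xc x1] := normalized_rootP Px.
have [i ei] := simple_nth aD.
have [j ji xj] : exists2 j, j != i & 0 < x_ j x.
  have [|none] := pselect (exists2 j, j != i & 0 < x_ j x); first by [].
  have x0 j : j != i -> x_ j x = 0.
    move=> ji; apply/eqP; rewrite eq_le xc andbT leNgt; apply/negP => xj.
    by apply: none; exists j.
  case/eqP: xa; apply: (coord_inj hb) => j; rewrite ei coord_simple // eq_sym.
  have [->|/x0//] := eqVneq j i.
  by rewrite -x1 /coord_sum (bigD1 i) //= big1 ?addr0.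
have [n0 Ps] := normalized_roots_stable (weyl_reflection aD) Px.
have [/in_coneP zc _] := normalized_rootP Ps.
have ey : s a x = csum (s a x) *: nrm (s a x) by rewrite scalerA divff // scale1r.
have yj : x_ j (s a x) = x_ j x.
  rewrite reflection_unitE ?(simple_unit hD) // linearB linearZ /= ei coord_simple //.
  by rewrite eq_sym (negbTE ji) mulr0 subr0.
have k0 : 0 < csum (s a x).
  rewrite lt_def n0 /= leNgt; apply/negP => k0.
  move: xj; rewrite -yj ey linearZ /= ltNge => /negP; apply.
  by rewrite mulr_le0_ge0 ?zc // ltW.
rewrite ey; apply/in_coneP => l; rewrite linearZ /=.
by rewrite mulr_ge0 ?zc // ltW.
Qed.

Lemma limit_root_cone x : E x -> in_cone x /\ csum x = 1.
Proof.
move=> [u [_ uP ux]]; split.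
  apply/in_coneP => i.
  have uxi := euclidean_cvg_scalar (x_ i : {scalar V}) ux; apply: (cvgr_to_ge uxi).
  by near=> n; have [/in_coneP + _] := normalized_rootP (uP n); apply.
have := euclidean_cvg_scalar (csum : {scalar V}) ux.
have -> : (fun n => csum (u n)) = cst 1.
  by apply/funext => n; have [] := normalized_rootP (uP n).
move=> c1; exact: (cvg_unique _ c1 (cvg_cst _)).
Unshelve. all: by end_near.
Qed.

(** The only normalized root that s_a moves out of the cone is a, and an injective
    sequence takes this value at most once; the cone is closed. *)
Lemma limit_root_reflection_cone a u x : a \in Delta -> injective u ->
  (forall n, hPhi (u n)) -> (u : nat -> euclidean V) @ \oo --> (x : euclidean V) ->
  in_cone (s a x).
Proof.
move=> aD inju uP ux; apply/in_coneP => i.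
have sux := euclidean_cvg_scalar (x_ i \o s a : {scalar V}) ux.
apply: (cvgr_to_ge sux).
have [[k uk]|nk] := pselect (exists k, u k = a).
  near=> n; have un : u n != a.
    rewrite -uk (inj_eq inju) neq_ltn; apply/orP; right.
    by near: n; exists k.+1.
  by have /in_coneP := reflection_normalized_root aD (uP n) un; apply.
near=> n; have un : u n != a by apply/eqP => un; apply: nk; exists n.
by have /in_coneP := reflection_normalized_root aD (uP n) un; apply.
Unshelve. all: by end_near.
Qed.

(** If u converges to a, then s_a u n converges to s_a a = - a, which is outside
    the closed cone. *)
Lemma simple_notin_limit_roots a : a \in Delta -> ~ E a.
Proof.
move=> aD [u [inju uP ua]].
have := limit_root_reflection_cone aD inju uP ua.
rewrite reflection_id ?(simple_unit hD) // => /in_coneP.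
have [i ei] := simple_nth aD => /(_ i).
by rewrite linearN /= ei (coord_simple hb) eqxx oppr_ge0 ler10.
Qed.

(** As s_a x is a nonzero vector of the cone, normalization is continuous there,
    and carries the s_a u n to an injective sequence of normalized roots. *)
Lemma limit_roots_reflection a x : a \in Delta -> E x ->
  csum (s a x) != 0 /\ E (nrm (s a x)).
Proof.
move=> aD Ex; have [xc x1] := limit_root_cone Ex.
have sK := reflectionK (simple_unit hD aD).
have [u [inju uP ux]] := Ex.
have sc := limit_root_reflection_cone aD inju uP ux.
have sx0 : csum (s a x) != 0.
  rewrite gt_eqF // coord_sum_gt0 //; apply/eqP => sx.
  by move: x1; rewrite -(sK x) sx !linear0 => /eqP; rewrite eq_sym oner_eq0.
split=> //; exists (fun n => nrm (s a (u n))); split.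
- have back v : hPhi v -> nrm (s a (nrm (s a v))) = v.
    move=> Pv; have [n0 _] := normalized_roots_stable (weyl_reflection aD) Pv.
    by rewrite normalize_lfun // sK normalize_id //; case: (normalized_rootP Pv).
  by move=> m n e; apply: inju; rewrite -(back _ (uP m)) e back.
- by move=> n; case: (normalized_roots_stable (weyl_reflection aD) (uP n)).
apply: euclidean_cvg_of_scalars => phi.
rewrite /normalize linearZ; under eq_fun do rewrite linearZ.
apply: cvgM; last exact: (euclidean_cvg_scalar (phi \o s a : {scalar V}) ux).
by apply: cvgV => //; apply: (euclidean_cvg_scalar (csum \o s a : {scalar V}) ux).
Qed.

Lemma limit_roots_stable f x : W f -> E x -> csum (f x) != 0 /\ E (nrm (f x)).
Proof.
apply: stable_simple; first by move=> y /limit_root_cone[].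
exact: limit_roots_reflection.
Qed.

(** The inverse of f moves a common point f a to the simple root a, by stability
    of E. *)
Lemma normalized_limit_disjoint : hPhi `&` E = set0.
Proof.
apply/seteqP; split=> // x [[_ [f Wf [a aD <-]] <-]] Ex.
have fa0 : csum (f a) != 0.
  by apply/coord_sum_root/root_system_weyl => //; apply: simple_root_system.
have [_] := limit_roots_stable (weyl_inv Wf) Ex.
rewrite normalize_lfun // lker0_lfunK ?weyl_lker // normalize_id ?coord_sum_simple //.
exact: simple_notin_limit_roots.
Qed.

End LimitRoots.

Theorem proposition3p1 (R : realType) (V : vectType R) (B : {symmetric V})
    (Delta : seq V)
    (hDelta : simple_system B Delta)
    (hbasis : basis_of {:V} Delta)
    (hinf : infinite_set (root_system B Delta)) :
  let hPhi := normalized_roots B Delta in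
  let E := limit_roots B Delta in
  [/\ hPhi `<=` act_domain B Delta /\ E `<=` act_domain B Delta,
      [/\ proj_act_stable B Delta hPhi, proj_act_stable B Delta E &
          hPhi = [set proj_act Delta w a | w in weyl_group B Delta
                                    & a in [set` Delta]]] &
      [/\ top_closure hPhi = hPhi `|` E, hPhi `&` E = set0 &
          proj_act_stable B Delta (top_closure hPhi)]].
Proof.
move=> hPhi E.
have stP f x : weyl_group B Delta f -> hPhi x -> _ :=
  normalized_roots_stable hDelta hbasis (f := f) (x := x).
have stE f x : weyl_group B Delta f -> E x -> _ :=
  limit_roots_stable hDelta hbasis (f := f) (x := x).
split.
- split; apply: stable_act_domain => //.
  + by move=> x /(normalized_rootP hDelta hbasis)[].
  + by move=> f x Wf /(stP f x Wf)[].
  + by move=> x /(limit_root_cone hDelta hbasis)[].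
  + by move=> f x Wf /(stE f x Wf)[].
- split; [by move=> f x Wf /(stP f x Wf)[]|by move=> f x Wf /(stE f x Wf)[]|].
  apply/seteqP; split=> x.
    by move=> [_ [f Wf [a aD <-]] <-]; exists f => //; exists a.
  by move=> [f Wf [a aD <-]]; exists (f a) => //; exists f => //; exists a.
- split; [exact: top_closureE|exact: normalized_limit_disjoint|].
  rewrite top_closureE => f x Wf [/(stP f x Wf)[_]|/(stE f x Wf)[_]]; first by left.
  by right.
Qed.
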